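(* Let $(H;\langle\cdot,\cdot\rangle)$ be an inner product space over $\mathbb{K}$ ($\mathbb{K}=\mathbb{R}$ or $\mathbb{K}=\mathbb{C}$), and let $x,a\in H$ and $r>0$ be such that $x\in\overline{B}(a,r):=\{z\in H : \|z-a\|\le r\}$. (i) If $\|a\|>r$, then $$0\le \|x\|^2\|a\|^2-|\langle x,a\rangle|^2\le \|x\|^2\|a\|^2-[\operatorname{Re}\langle x,a\rangle]^2\le r^2\|x\|^2 .$$ The constant $C=1$ in front of $r^2$ is best possible in the sense that it cannot be replaced by a smaller one. (ii) If $\|a\|=r$, then $$\|x\|^2\le 2\operatorname{Re}\langle x,a\rangle\le 2|\langle x,a\rangle| .$$ The constant $2$ is best possible in both inequalities (i.e. in each of the two upper bounds for $\|x\|^2$). (iii) If $\|a\|<r$, then $$\|x\|^2\le r^2-\|a\|^2+2\operatorname{Re}\langle x,a\rangle\le r^2-\|a\|^2+2|\langle x,a\rangle| .$$ Here the constant $2$ is also best possible.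
   Context: The inner product is linear in its first argument and $\|z\|=\sqrt{\langle z,z\rangle}$. A constant is called best possible if no smaller constant makes the corresponding inequality valid for all inner product spaces over $\mathbb{K}$ and all data satisfying the hypotheses of the part in question. *)

(* Defs.v *)
From HB Require Import structures.
From mathcomp Require Import all_boot all_order all_algebra.
From mathcomp Require Import complex.
From mathcomp Require Import classical_sets reals.

Set Implicit Arguments.
Unset Strict Implicit.
Unset Printing Implicit Defensive.

Import Order.TTheory GRing.Theory Num.Theory.
Local Open Scope classical_set_scope.
Local Open Scope ring_scope.

Variant scalar_kind := RealScalars | ComplexScalars.

Definition scalars (R : realType) (k : scalar_kind) : numFieldType :=
  match k with RealScalars => R | ComplexScalars => R[i] end.

Definition sconj (R : realType) (k : scalar_kind) : scalars R k -> scalars R k :=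
  match k with RealScalars => idfun | ComplexScalars => Num.conj end.

Definition sRe (R : realType) (k : scalar_kind) : scalars R k -> R :=
  match k with RealScalars => idfun | ComplexScalars => @complex.Re R end.

(* The norm `|z| of a complex number lives in R[i]; sRe brings it back to R. *)
Definition sabs (R : realType) (k : scalar_kind) (z : scalars R k) : R :=
  sRe `|z|.

(* A form ip : {dot H for @sconj R k} is an inner product on H: positive
   definite, linear in its first argument, and Hermitian (symmetric over R). *)
Section InnerProductSpace.
Variables (R : realType) (k : scalar_kind) (H : lmodType (scalars R k)).
Variable ip : {dot H for @sconj R k}.

Definition ip_norm (z : H) : R := Num.sqrt (sRe (ip z z)).

Definition ip_closed_ball (a : H) (r : R) : set H :=
  [set z | ip_norm (z - a) <= r].

End InnerProductSpace.

(* Main.v *)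
Require Import Defs.
From HB Require Import structures.
From mathcomp Require Import all_boot all_order all_algebra.
From mathcomp Require Import complex.
From mathcomp Require Import classical_sets reals.
From mathcomp Require Import ring lra.

(** Write [X], [A] for the squared norms of [x] and [a], and [p] for the real
    part of their inner product. Expanding the square of the norm of [x - a],
    membership in the ball reads
      [X + (A - r^2) <= 2 p]
    (lemma [closed_ball_sqr]). For [A = r^2] and [A < r^2] this is already the
    required bound, since [p] is at most the modulus of the inner product. For
    [A > r^2] both terms on the left are nonnegative, so squaring and the
    inequality [4 X (A - r^2) <= (X + (A - r^2))^2] give [X (A - r^2) <= p^2],
    which is the upper bound of the first part; its lower bound is the
    Cauchy-Schwarz inequality.

    The constants are best possible because each bound is attained with [p]
    equal to the modulus of the inner product, and what the constant multiplies,
    [r^2 X] or [p], is then positive. Vectors with natural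
    coordinates in the plane over the scalars suffice:
    [x = (1, 0)], [a = (1, 1)], [r = 1] when [a] is outside the ball of radius
    [r] around the origin, [x = (2, 0)], [a = (1, 0)], [r = 1] when it is on
    its boundary, [x = (3, 0)], [a = (1, 0)], [r = 2] when it is inside. Their
    inner products are natural numbers, so real and complex scalars need no
    separate treatment. *)

Set Implicit Arguments.
Unset Strict Implicit.
Unset Printing Implicit Defensive.

Import Order.TTheory GRing.Theory Num.Theory.
Local Open Scope ring_scope.

(** * Real part, modulus and conjugation of scalars *)

Section Scalars.
Variables (R : realType) (k : scalar_kind).
Implicit Types x y z : scalars R k.

Lemma sReD x y : sRe (x + y) = sRe x + sRe y.
Proof. by case: k x y => [//|] [a b] [c d]. Qed.

Lemma sReN x : sRe (- x) = - sRe x.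
Proof. by case: k x => [//|] [a b]. Qed.

Lemma sRe_nat n : sRe (n%:R : scalars R k) = n%:R.
Proof. by elim: n => [|n IH]; [case: k | rewrite !mulrS sReD IH; case: k]. Qed.

Lemma sRe_ge0 x : 0 <= x -> 0 <= sRe x.
Proof. by case: k x => [//|] [a b]; rewrite lecE => /andP[]. Qed.

Lemma sRe_le x y : x <= y -> sRe x <= sRe y.
Proof. by rewrite -subr_ge0 => /sRe_ge0; rewrite sReD sReN subr_ge0. Qed.

(** A nonnegative complex number is real, and the real part is linear over
    the reals. *)
Lemma sReM_ge0 x y : 0 <= x -> sRe (x * y) = sRe x * sRe y.
Proof.
case: k x y => [//|] [a b] [c d]; rewrite lecE => /andP[/eqP /= -> _].
by rewrite mul0r subr0.
Qed.

Lemma sabs_nat n : sabs (n%:R : scalars R k) = n%:R.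
Proof. by rewrite /sabs normr_nat sRe_nat. Qed.

Lemma sRe_sabs x : `|sRe x| <= sabs x.
Proof.
case: k x => [//|] [a b]; rewrite /sabs /= -sqrtr_sqr ler_wsqrtr //.
by rewrite lerDl sqr_ge0.
Qed.

Lemma sRe_sqr_le x : sRe x ^+ 2 <= sabs x ^+ 2.
Proof.
rewrite -[leLHS]real_normK ?num_real //.
by rewrite lerXn2r ?nnegrE ?(le_trans _ (sRe_sabs x)) ?sRe_sabs.
Qed.

Lemma sRe_conj x : sRe (sconj x) = sRe x.
Proof. by case: k x => [//|] [a b]. Qed.

Lemma mul_sconj x : x * sconj x = `|x| ^+ 2.
Proof.
case: k x => [x|x]; last by rewrite normCK.
by rewrite -normrX ger0_norm ?sqr_ge0.
Qed.

Lemma sconj_nat n : sconj (n%:R : scalars R k) = n%:R.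
Proof. by case: k => //=; rewrite conjC_nat. Qed.

Lemma sconjD x y : sconj (x + y) = sconj x + sconj y.
Proof. by case: k x y => [//|x y]; rewrite /= rmorphD. Qed.

Lemma sconjM x y : sconj (x * y) = sconj x * sconj y.
Proof. by case: k x y => [//|x y]; rewrite /= rmorphM. Qed.

Lemma sconjK : involutive (@sconj R k).
Proof. by case: k => [//|x]; rewrite /= conjCK. Qed.

End Scalars.

(** [hermC], [rmorph_sum] and their kin apply only to a conjugation that is
    known to be a ring morphism. *)
HB.instance Definition _ (R : realType) (k : scalar_kind) :=
  GRing.isNmodMorphism.Build _ _ (@sconj R k)
    (conj (sconj_nat R k 0) (@sconjD R k)).
HB.instance Definition _ (R : realType) (k : scalar_kind) :=
  GRing.isMonoidMorphism.Build _ _ (@sconj R k)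
    (conj (sconj_nat R k 1) (@sconjM R k)).

(** * Norms, balls and the Cauchy-Schwarz inequality *)

Section InnerProduct.
Variables (R : realType) (k : scalar_kind) (H : lmodType (scalars R k)).
Variable ip : {dot H for @sconj R k}.
Implicit Types x a : H.

Lemma ipC x a : ip x a = sconj (ip a x).
Proof. by rewrite hermC expr0 mul1r. Qed.

Lemma ip_ge0 x : 0 <= ip x x.
Proof.
by have [->|x0] := eqVneq x 0; rewrite ?linear0l // ltW ?neq0_dnorm_gt0.
Qed.

Lemma sqr_ip_norm x : ip_norm ip x ^+ 2 = sRe (ip x x).
Proof. by rewrite sqr_sqrtr ?sRe_ge0 ?ip_ge0. Qed.

Lemma sqr_ip_normB x a :
  ip_norm ip (x - a) ^+ 2 =
  ip_norm ip x ^+ 2 - 2 * sRe (ip x a) + ip_norm ip a ^+ 2.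
Proof.
rewrite !sqr_ip_norm linearBl 2!linearBr /= (ipC a x).
by rewrite !(sReD, sReN) sRe_conj; ring.
Qed.

Lemma closed_ball_sqr a r x : 0 < r -> ip_closed_ball ip a r x ->
  ip_norm ip x ^+ 2 + (ip_norm ip a ^+ 2 - r ^+ 2) <= 2 * sRe (ip x a).
Proof.
move=> r0 xar; have : ip_norm ip (x - a) ^+ 2 <= r ^+ 2.
  by rewrite lerXn2r ?nnegrE ?sqrtr_ge0 ?(ltW r0).
by rewrite sqr_ip_normB; lra.
Qed.

(** For nonzero [a], the vector [<a, a> x - <x, a> a] is orthogonal to [a], and
    its inner product with itself is
    [<a, a> (<x, x> <a, a> - |<x, a>|^2)]. *)
Lemma ip_Cauchy_Schwarz x a :
  sabs (ip x a) ^+ 2 <= ip_norm ip x ^+ 2 * ip_norm ip a ^+ 2.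
Proof.
have -> : sabs (ip x a) ^+ 2 = sRe (`|ip x a| ^+ 2).
  by rewrite !expr2 sReM_ge0.
rewrite !sqr_ip_norm -sReM_ge0 ?ip_ge0 //; apply: sRe_le.
have [->|a0] := eqVneq a 0; first by rewrite !linear0r normr0 mulr0 expr0n.
have A0 : 0 < ip a a by rewrite neq0_dnorm_gt0.
have := ip_ge0 (ip a a *: x - ip x a *: a).
rewrite linearBl 2!linearBr /= !linearZl_LR !linearZr_LR /=.
rewrite -(ipC a a) (ipC a x) -mul_sconj => h.
rewrite -subr_ge0 -(pmulr_rge0 _ A0).
by apply: le_trans h _; rewrite le_eqVlt; apply/orP; left; apply/eqP; ring.
Qed.

(** The number [A - r^2] is the power of the origin with respect to the sphere;
    it is nonnegative here, so squaring [closed_ball_sqr] is legitimate and the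
    arithmetic-geometric mean inequality applies. *)
Lemma ball_reverse_Cauchy_Schwarz a r x :
    0 < r -> ip_closed_ball ip a r x -> r <= ip_norm ip a ->
  ip_norm ip x ^+ 2 * ip_norm ip a ^+ 2 - sRe (ip x a) ^+ 2
    <= r ^+ 2 * ip_norm ip x ^+ 2.
Proof.
move=> r0 xar ra; have := closed_ball_sqr r0 xar.
have : r ^+ 2 <= ip_norm ip a ^+ 2.
  by rewrite lerXn2r ?nnegrE ?sqrtr_ge0 // ltW.
have := sqr_ge0 (ip_norm ip x).
set D := r ^+ 2; set X := _ ^+ 2; set A := _ ^+ 2; set p := sRe _.
move=> X0 DA h.
have : (X + (A - D)) ^+ 2 <= (2 * p) ^+ 2 by rewrite lerXn2r ?nnegrE; lra.
by have := sqr_ge0 (X - (A - D)); lra.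
Qed.

End InnerProduct.

(** * The standard inner product on row vectors *)

Section RowDot.
Variables (R : realType) (k : scalar_kind) (n : nat).
Notation K := (scalars R k).
Implicit Types u v w : 'rV[K]_n.

Definition row_dot u v : K := \sum_i u 0 i * sconj (v 0 i).

Lemma row_dotDl v : zmod_morphism (row_dot^~ v).
Proof.
move=> u w; rewrite /row_dot -sumrB; apply: eq_bigr => i _.
by rewrite !mxE mulrBl.
Qed.

Lemma row_dotZl v : scalable_for *%R (row_dot^~ v).
Proof.
move=> c u; rewrite /row_dot mulr_sumr; apply: eq_bigr => i _.
by rewrite !mxE mulrA.
Qed.

Lemma row_dotC u v : row_dot u v = sconj (row_dot v u).
Proof.
rewrite /row_dot rmorph_sum; apply: eq_bigr => i _.
by rewrite rmorphM /= sconjK mulrC.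
Qed.

Lemma row_dotDr u : zmod_morphism (row_dot u).
Proof. by move=> v w; rewrite !(row_dotC u) row_dotDl rmorphB. Qed.

Lemma row_dotZr u : scalable_for (@sconj R k \; *%R) (row_dot u).
Proof. by move=> c v; rewrite !(row_dotC u) row_dotZl rmorphM. Qed.

Lemma row_dot_hermitian u v : row_dot u v = (-1) ^+ false * sconj (row_dot v u).
Proof. by rewrite expr0 mul1r row_dotC. Qed.

Lemma row_dot_gt0 u : u != 0 -> 0 < row_dot u u.
Proof.
move=> u0; have t0 i : 0 <= u 0 i * sconj (u 0 i).
  by rewrite mul_sconj exprn_ge0.
rewrite lt_neqAle eq_sym sumr_ge0 // andbT; apply: contra u0.
rewrite psumr_eq0 // => /allP h; apply/eqP/rowP => i; rewrite mxE; apply/eqP.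
have := h i (mem_index_enum i).
by rewrite mul_sconj expf_eq0 normr_eq0.
Qed.

HB.instance Definition _ := isBilinear.Build K _ _ _ _ _ row_dot
  row_dotDl row_dotDr row_dotZl row_dotZr.
HB.instance Definition _ := isHermitianSesquilinear.Build K _ false
  (@sconj R k) row_dot row_dot_hermitian.
HB.instance Definition _ := isDotProduct.Build K _ row_dot row_dot_gt0.

End RowDot.

(** * Extremal configurations in the plane *)

Section Plane.
Variables (R : realType) (k : scalar_kind).

Definition nat_vec (p q : nat) : 'rV[scalars R k]_2 :=
  \row_i (if i == 0 then p else q)%:R.

Definition plane_dot : {dot 'rV[scalars R k]_2 for @sconj R k} :=
  @row_dot R k 2.

Lemma plane_dot_nat p q p' q' :
  plane_dot (nat_vec p q) (nat_vec p' q') = (p * p' + q * q')%:R.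
Proof.
rewrite /= /row_dot !big_ord_recl big_ord0 !mxE /= !sconj_nat.
by rewrite addr0 natrD !natrM.
Qed.

Lemma sqr_norm_nat_vec p q :
  ip_norm plane_dot (nat_vec p q) ^+ 2 = (p * p + q * q)%:R.
Proof. by rewrite sqr_ip_norm plane_dot_nat sRe_nat. Qed.

Lemma norm_nat_vec p q :
  ip_norm plane_dot (nat_vec p q) = Num.sqrt (p * p + q * q)%:R.
Proof. by rewrite /ip_norm plane_dot_nat sRe_nat. Qed.

Lemma natr_sqrt (n : nat) : n%:R = Num.sqrt (n * n)%:R :> R.
Proof. by rewrite natrM -expr2 sqrtr_sqr ger0_norm. Qed.

Lemma closed_ball_nat p q p' q' n :
  (p * p + q * q + (p' * p' + q' * q') <= n * n + 2 * (p * p' + q * q'))%N ->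
  ip_closed_ball plane_dot (nat_vec p' q') n%:R (nat_vec p q).
Proof.
rewrite -(ler_nat R) !natrD natrM => h.
rewrite /ip_closed_ball /= -(@ler_pXn2r _ 2) ?nnegrE ?sqrtr_ge0 //.
rewrite sqr_ip_normB !sqr_norm_nat_vec plane_dot_nat sRe_nat !natrD.
by move: h; rewrite !natrM; lra.
Qed.

(** Here [x = (1, 0)] and [a = x + (0, 1)], so that [x] is the point of tangency
    of a line through the origin with the circle of centre [a] and radius 1:
    both steps of the proof of [ball_reverse_Cauchy_Schwarz] are equalities. *)
Lemma nat_vec_outside :
  ip_closed_ball plane_dot (nat_vec 1 1) 1 (nat_vec 1 0) /\
  1 < ip_norm plane_dot (nat_vec 1 1).
Proof.
split; first exact: (@closed_ball_nat _ _ _ _ 1).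
rewrite norm_nat_vec -[ltLHS]/(1%:R) [ltLHS]natr_sqrt.
by rewrite ltr_sqrt ?ltr_nat ?ltr0n.
Qed.

(** The antipode [x = 2a] of the origin lies on the sphere and on the ray
    through [a]; being on the sphere turns the bound into an equality, and
    being a positive multiple of [a] makes the inner product equal to its
    modulus. *)
Lemma nat_vec_boundary :
  ip_closed_ball plane_dot (nat_vec 1 0) 1 (nat_vec 2 0) /\
  ip_norm plane_dot (nat_vec 1 0) = 1.
Proof.
split; first exact: (@closed_ball_nat _ _ _ _ 1).
by rewrite norm_nat_vec sqrtr1.
Qed.

(** As on the boundary: [x = 3a] is where the ray through [a] leaves the ball. *)
Lemma nat_vec_inside :
  ip_closed_ball plane_dot (nat_vec 1 0) 2 (nat_vec 3 0) /\
  ip_norm plane_dot (nat_vec 1 0) < 2.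
Proof.
split; first exact: (@closed_ball_nat _ _ _ _ 2).
by rewrite norm_nat_vec sqrtr1 ltr1n.
Qed.

End Plane.

Theorem theorem1 (R : realType) (k : scalar_kind) :
  (* (i) *)
  [/\ forall (H : lmodType (scalars R k)) (ip : {dot H for @sconj R k})
        (x a : H) (r : R),
        0 < r -> ip_closed_ball ip a r x -> r < ip_norm ip a ->
        [/\ 0 <= ip_norm ip x ^+ 2 * ip_norm ip a ^+ 2 - sabs (ip x a) ^+ 2,
            ip_norm ip x ^+ 2 * ip_norm ip a ^+ 2 - sabs (ip x a) ^+ 2
              <= ip_norm ip x ^+ 2 * ip_norm ip a ^+ 2 - sRe (ip x a) ^+ 2
          & ip_norm ip x ^+ 2 * ip_norm ip a ^+ 2 - sRe (ip x a) ^+ 2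
              <= r ^+ 2 * ip_norm ip x ^+ 2],
      forall C : R, C < 1 ->
        ~ (forall (H : lmodType (scalars R k)) (ip : {dot H for @sconj R k})
             (x a : H) (r : R),
             0 < r -> ip_closed_ball ip a r x -> r < ip_norm ip a ->
             ip_norm ip x ^+ 2 * ip_norm ip a ^+ 2 - sRe (ip x a) ^+ 2
               <= C * r ^+ 2 * ip_norm ip x ^+ 2)
    & forall C : R, C < 1 ->
        ~ (forall (H : lmodType (scalars R k)) (ip : {dot H for @sconj R k})
             (x a : H) (r : R),
             0 < r -> ip_closed_ball ip a r x -> r < ip_norm ip a ->
             ip_norm ip x ^+ 2 * ip_norm ip a ^+ 2 - sabs (ip x a) ^+ 2
               <= C * r ^+ 2 * ip_norm ip x ^+ 2)]
  /\
  (* (ii) *)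
  [/\ forall (H : lmodType (scalars R k)) (ip : {dot H for @sconj R k})
        (x a : H) (r : R),
        0 < r -> ip_closed_ball ip a r x -> ip_norm ip a = r ->
        ip_norm ip x ^+ 2 <= 2 * sRe (ip x a) /\
        2 * sRe (ip x a) <= 2 * sabs (ip x a),
      forall C : R, C < 2 ->
        ~ (forall (H : lmodType (scalars R k)) (ip : {dot H for @sconj R k})
             (x a : H) (r : R),
             0 < r -> ip_closed_ball ip a r x -> ip_norm ip a = r ->
             ip_norm ip x ^+ 2 <= C * sRe (ip x a))
    & forall C : R, C < 2 ->
        ~ (forall (H : lmodType (scalars R k)) (ip : {dot H for @sconj R k})
             (x a : H) (r : R),
             0 < r -> ip_closed_ball ip a r x -> ip_norm ip a = r ->
             ip_norm ip x ^+ 2 <= C * sabs (ip x a))]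
  /\
  (* (iii) *)
  [/\ forall (H : lmodType (scalars R k)) (ip : {dot H for @sconj R k})
        (x a : H) (r : R),
        0 < r -> ip_closed_ball ip a r x -> ip_norm ip a < r ->
        ip_norm ip x ^+ 2 <= r ^+ 2 - ip_norm ip a ^+ 2 + 2 * sRe (ip x a) /\
        r ^+ 2 - ip_norm ip a ^+ 2 + 2 * sRe (ip x a)
          <= r ^+ 2 - ip_norm ip a ^+ 2 + 2 * sabs (ip x a),
      forall C : R, C < 2 ->
        ~ (forall (H : lmodType (scalars R k)) (ip : {dot H for @sconj R k})
             (x a : H) (r : R),
             0 < r -> ip_closed_ball ip a r x -> ip_norm ip a < r ->
             ip_norm ip x ^+ 2
               <= r ^+ 2 - ip_norm ip a ^+ 2 + C * sRe (ip x a))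
    & forall C : R, C < 2 ->
        ~ (forall (H : lmodType (scalars R k)) (ip : {dot H for @sconj R k})
             (x a : H) (r : R),
             0 < r -> ip_closed_ball ip a r x -> ip_norm ip a < r ->
             ip_norm ip x ^+ 2
               <= r ^+ 2 - ip_norm ip a ^+ 2 + C * sabs (ip x a))].

Proof.
split; [|split]; split.
- move=> H ip x a r r0 xar ra; have cs := ip_Cauchy_Schwarz ip x a.
  split; [by rewrite subr_ge0 | by rewrite lerD2l lerN2 sRe_sqr_le |].
  exact: ball_reverse_Cauchy_Schwarz r0 xar (ltW ra).
- move=> C C1 h; have [xar ra] := nat_vec_outside R k.
  have := h _ _ _ _ _ ltr01 xar ra.
  by rewrite !sqr_norm_nat_vec plane_dot_nat sRe_nat /=; lra.
- move=> C C1 h; have [xar ra] := nat_vec_outside R k.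
  have := h _ _ _ _ _ ltr01 xar ra.
  by rewrite !sqr_norm_nat_vec plane_dot_nat sabs_nat /=; lra.
- move=> H ip x a r r0 xar ra; have := closed_ball_sqr r0 xar.
  have := le_trans (ler_norm _) (sRe_sabs (ip x a)).
  by rewrite ra subrr addr0; split; lra.
- move=> C C2 h; have [xar ra] := nat_vec_boundary R k.
  have := h _ _ _ _ _ ltr01 xar ra.
  by rewrite sqr_norm_nat_vec plane_dot_nat sRe_nat /=; lra.
- move=> C C2 h; have [xar ra] := nat_vec_boundary R k.
  have := h _ _ _ _ _ ltr01 xar ra.
  by rewrite sqr_norm_nat_vec plane_dot_nat sabs_nat /=; lra.
- move=> H ip x a r r0 xar ra; have := closed_ball_sqr r0 xar.
  by have := le_trans (ler_norm _) (sRe_sabs (ip x a)); split; lra.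
- move=> C C2 h; have [xar ra] := nat_vec_inside R k.
  have := h _ _ _ _ _ (ltr0Sn R 1) xar ra.
  by rewrite !sqr_norm_nat_vec plane_dot_nat sRe_nat /=; lra.
- move=> C C2 h; have [xar ra] := nat_vec_inside R k.
  have := h _ _ _ _ _ (ltr0Sn R 1) xar ra.
  by rewrite !sqr_norm_nat_vec plane_dot_nat sabs_nat /=; lra.
Qed.
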